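(* Let $G$ be a connected graph of order $n$ with $n\geq 3$. Then $1\leq \kappa_3(G)\leq n-2$. Moreover, both the upper and the lower bound are sharp, i.e. for every $n\geq 3$ there exist a connected graph of order $n$ with $\kappa_3=n-2$ and a connected graph of order $n$ with $\kappa_3=1$.
   Context: All graphs are undirected, finite and simple; the order of a graph is its number of vertices. For a nonempty set $S\subseteq V(G)$, an $S$-tree (a tree connecting $S$) in $G$ is a subgraph $T$ of $G$ that is a tree with $S\subseteq V(T)$. A collection $T_1,\dots,T_\ell$ of $S$-trees in $G$ is internally disjoint if $E(T_i)\cap E(T_j)=\emptyset$ and $V(T_i)\cap V(T_j)=S$ for all distinct $i,j\in\{1,\dots,\ell\}$. For a connected graph $G$ of order $n$ and an integer $k$ with $2\leq k\leq n$, the generalized $k$-connectivity $\kappa_k(G)$ is the greatest positive integer $r$ such that for every set $S$ of $k$ vertices of $G$, $G$ contains at least $r$ internally disjoint trees connecting $S$. *)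

(* Defs.v *)
From mathcomp Require Import all_boot.
From mathcomp Require classical_sets.

Set Implicit Arguments.
Unset Strict Implicit.
Unset Printing Implicit Defensive.

Record sgraph := SGraph {
  vertex :> finType;
  adj : rel vertex;
  adj_sym : symmetric adj;
  adj_irrefl : irreflexive adj }.

(* Edges are encoded as the two-element sets of their endpoints. *)
Definition edges (G : sgraph) : {set {set G}} :=
  [set [set p.1; p.2] | p : G * G & adj p.1 p.2].

Definition connected_graph (G : sgraph) : Prop :=
  0 < #|G| /\ forall x y : G, connect (@adj G) x y.

Record subgraph (G : sgraph) := Subgraph {
  sub_vertices : {set G};
  sub_edges : {set {set G}};
  sub_edges_subset : sub_edges \subset edges G;
  sub_edges_incident : forall f, f \in sub_edges -> f \subset sub_vertices }.

Definition sub_adj (G : sgraph) (H : subgraph G) : rel G :=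
  fun x y => [set x; y] \in sub_edges H.

(* [ucycle] also accepts the closed walk x, y, x along a single edge, hence
   the bound on the size. *)
Definition is_tree (G : sgraph) (H : subgraph G) : Prop :=
  [/\ sub_vertices H != set0,
      {in sub_vertices H &, forall x y, connect (sub_adj H) x y} &
      forall c : seq G, 2 < size c -> ~ ucycle (sub_adj H) c].

Definition steiner_tree (G : sgraph) (S : {set G}) (H : subgraph G) : Prop :=
  is_tree H /\ S \subset sub_vertices H.

Definition internally_disjoint (G : sgraph) (S : {set G}) (l : nat)
    (t : 'I_l -> subgraph G) : Prop :=
  forall i j : 'I_l, i != j ->
    sub_edges (t i) :&: sub_edges (t j) = set0 /\
    sub_vertices (t i) :&: sub_vertices (t j) = S.

Definition has_disjoint_trees (G : sgraph) (k r : nat) : Prop :=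
  forall S : {set G}, #|S| = k ->
    exists t : 'I_r -> subgraph G,
      (forall i, steiner_tree S (t i)) /\ internally_disjoint S t.

Definition is_gen_connectivity (G : sgraph) (k r : nat) : Prop :=
  [/\ 0 < r, has_disjoint_trees G k r &
      forall r', has_disjoint_trees G k r' -> r' <= r].

(* Meant for G connected and 2 <= k <= #|G|; the value is 0 when no positive
   integer is the greatest one, so a positive value is always a genuine
   maximum. *)
Definition gen_connectivity (k : nat) (G : sgraph) : nat :=
  classical_sets.xget 0 (is_gen_connectivity G k).

(* Main.v *)
Require Import Defs.
From mathcomp Require Import all_boot.
From mathcomp Require boolp classical_sets.

Set Implicit Arguments.
Unset Strict Implicit.
Unset Printing Implicit Defensive.

(** All trees built here are given by a root and a parent map that decreases
a rank. Such a graph is connected, because every vertex descends to the root,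
and acyclic, because a vertex of largest rank on a cycle would have both of its
neighbours on the cycle equal to its parent ([parent_tree]).

Lower bound: in a connected graph, let the rank be the distance to a fixed
vertex; the breadth-first parents give a spanning tree, which connects every
[S] ([connected_has_tree]).

Upper bound: fix three vertices [S]. A tree connecting [S] either has a vertex
outside [S], which it shares with no other tree of the family, or has vertex
set [S]. Two trees on the same three vertices share an edge, so the second case
occurs at most once, and there are at most [(n - 3) + 1] trees
([disjoint_trees_bound]).

Sharpness: in the complete graph, the stars joining each vertex outside [S] to
[S], together with the star on [S] centred at one vertex of [S], are [n - 2]
internally disjoint trees ([complete_has_trees]). In a star, take [S] to contain
a leaf: the only edge at this leaf belongs to every tree connecting [S], so
there is at most one tree ([pendant_bound]). *)

Lemma mem_edges (G : sgraph) (x y : G) : ([set x; y] \in edges G) = adj x y.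
Proof.
apply/imsetP/idP => [[[a b] /= ab E]|xy]; last first.
  by exists (x, y); rewrite ?inE.
have /set2P xab : x \in [set a; b] by rewrite -E set21.
have /set2P yab : y \in [set a; b] by rewrite -E set22.
have /set2P axy : a \in [set x; y] by rewrite E set21.
have /set2P bxy : b \in [set x; y] by rewrite E set22.
move: ab; rewrite inE; case: axy xab yab => ->; case: bxy => -> //.
- by move=> _ [] ->.
- by rewrite adj_sym.
- by case=> ->.
Qed.

Section Subgraphs.

Variables (G : sgraph) (H : subgraph G).

Lemma sub_adj_sym : symmetric (sub_adj H).
Proof. by move=> x y; rewrite /sub_adj setUC. Qed.

Lemma sub_adj_adj x y : sub_adj H x y -> adj x y.
Proof. by rewrite -mem_edges; apply: (subsetP (sub_edges_subset H)). Qed.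

Lemma sub_adj_neq x y : sub_adj H x y -> x != y.
Proof. by move/sub_adj_adj; apply: contraTneq => ->; rewrite adj_irrefl. Qed.

Lemma sub_adj_vertex x y : sub_adj H x y -> y \in sub_vertices H.
Proof. by move/sub_edges_incident/subsetP; apply; rewrite set22. Qed.

Lemma steiner_tree_neighbour (S : {set G}) x z :
  steiner_tree S H -> x \in S -> z \in S -> z != x -> exists y, sub_adj H x y.
Proof.
move=> [[_ conH _] /subsetP sSH] xS zS zx.
have /connectP[[|y p] /= xp E] := conH x z (sSH _ xS) (sSH _ zS).
  by rewrite E eqxx in zx.
by case/andP: xp => xy _; exists y.
Qed.

End Subgraphs.

(** * Trees given by a parent map *)

(** A cycle, rotated to start at an element of largest rank, has both neighbours
of that element among its neighbours of no larger rank; these coincide, but a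
cycle of length at least three has no repetition. *)
Lemma ranked_acyclic (T : finType) (e : rel T) (rank : T -> nat) :
    symmetric e ->
    (forall x y z, e x y -> e x z -> rank y <= rank x -> rank z <= rank x ->
       y = z) ->
  forall c : seq T, 2 < size c -> ~ ucycle e c.
Proof.
move=> e_sym uniq_low c c_gt2 /andP[ec Uc].
have [x xc xmax] : exists2 x, x \in c & forall y, y \in c -> rank y <= rank x.
  case: c c_gt2 {ec Uc} => // a c _.
  case: (@arg_maxnP T a (mem (a :: c)) rank (mem_head a c)) => x xc xmax.
  by exists x => // y /xmax.
case: (rot_to xc) => i c' Ec.
move: ec Uc c_gt2 xmax; rewrite -(rot_cycle i) -(rot_uniq i) -(size_rot i c).
move=> ec Uc c_gt2 xmax.
have {}xmax y : y \in rot i c -> rank y <= rank x by rewrite mem_rot => /xmax.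
move: ec Uc c_gt2 xmax; rewrite Ec.
case/lastP: c' {Ec} => [|[|y p] z] //= ; rewrite rcons_path last_rcons.
case/and3P=> xy _ zx /and3P[_ yp _] _ xmax.
have yz : y = z.
  apply: (uniq_low x) => //; first by rewrite e_sym.
    by apply: xmax; rewrite !inE eqxx orbT.
  by apply: xmax; rewrite !inE mem_rcons mem_head !orbT.
by rewrite yz mem_rcons mem_head in yp.
Qed.

(** Parents lead down to the root, so the graph is connected. The only
neighbour of [x] whose rank is at most that of [x] is its parent, since the
children of [x] have larger rank; so [ranked_acyclic] excludes cycles. *)
Lemma parent_tree (G : sgraph) (A : {set G}) (r : G) (p : G -> G)
    (rank : G -> nat) :
    r \in A ->
    (forall x, x \in A -> x != r ->
       [/\ p x \in A, adj x (p x) & rank (p x) < rank x]) ->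
  exists H : subgraph G,
    [/\ is_tree H, sub_vertices H = A &
        sub_edges H = [set [set x; p x] | x in A :\ r]].
Proof.
move=> rA parent; pose E := [set [set x; p x] | x in A :\ r].
have subE : E \subset edges G.
  apply/subsetP=> f /imsetP[x /setD1P[xr xA] ->].
  by rewrite mem_edges; case: (parent x xA xr).
have incE f : f \in E -> f \subset A.
  case/imsetP=> x /setD1P[xr xA] ->.
  by rewrite subUset !sub1set xA; case: (parent x xA xr).
exists (Subgraph subE incE); set H := Subgraph _ _; split=> //; split=> /=.
- by apply/set0Pn; exists r.
- have to_root x : x \in A -> connect (sub_adj H) x r.
    have [m] := ubnP (rank x); elim: m x => // m IHm x /ltnSE xm xA.
    have [->|xr] := eqVneq x r; first exact: connect0.
    have [pA _ px] := parent x xA xr.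
    apply: connect_trans (IHm (p x) (leq_trans px xm) pA).
    by apply/connect1/imsetP; exists x => //; rewrite !inE xr.
  move=> x y xA yA; apply: connect_trans (to_root x xA) _.
  by rewrite (sym_connect_sym (@sub_adj_sym _ H)) to_root.
- apply: (@ranked_acyclic _ _ rank (@sub_adj_sym _ H)).
  suff low x y : sub_adj H x y -> rank y <= rank x -> y = p x.
    by move=> x y z xy xz yx zx; rewrite (low x y) // (low x z).
  move=> xy yx; have nxy := sub_adj_neq xy.
  case/imsetP: xy => w /setD1P[wr wA] xyw.
  have [_ _ pw] := parent w wA wr.
  have /set2P[xw|xw] : x \in [set w; p w] by rewrite -xyw set21.
    have /set2P[yw|yw] : y \in [set w; p w] by rewrite -xyw set22.
      by rewrite xw yw eqxx in nxy.
    by rewrite xw.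
  have /set2P[yw|yw] : y \in [set w; p w] by rewrite -xyw set22.
    by rewrite xw yw leqNgt pw in yx.
  by rewrite xw yw eqxx in nxy.
Qed.

(** The penultimate vertex of a shortest path from the root is a parent. *)
Lemma distance_parent (G : sgraph) (r : G) :
    (forall x : G, connect (@adj G) r x) ->
  exists (p : G -> G) (rank : G -> nat),
    forall x, x != r -> adj x (p x) /\ rank (p x) < rank x.
Proof.
move=> conr.
pose reach x n := [exists q : n.-tuple G, path (@adj G) r q && (last r q == x)].
have reachI x q : path (@adj G) r q -> last r q = x -> reach x (size q).
  by move=> rq <-; apply/existsP; exists (in_tuple q); rewrite rq eqxx.
have /fin_all_exists[rank rankP] x :
    exists d, reach x d /\ forall n, reach x n -> d <= n.
  have ex_reach : exists n, reach x n.
    by case/connectP: (conr x) => q rq Eq; exists (size q); apply: reachI.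
  by case: (ex_minnP ex_reach) => n; exists n.
have /fin_all_exists[p parent] x :
    exists y, x != r -> adj x y /\ rank y < rank x.
  have [/existsP[q /andP[rq /eqP Eq]] _] := rankP x.
  have [xr|xr] := eqVneq x r; first by exists x.
  move: (size_tuple q) rq Eq; case/lastP: (tval q) => [|s y] /= szq.
    by move=> _ rx; rewrite rx eqxx in xr.
  rewrite rcons_path last_rcons => /andP[rs sy] yx.
  exists (last r s) => _; split; first by rewrite adj_sym -yx.
  by rewrite -szq size_rcons ltnS; apply: (rankP _).2; apply: reachI.
by exists p, rank.
Qed.

Lemma connected_has_tree (G : sgraph) (k : nat) :
  connected_graph G -> has_disjoint_trees G k 1.
Proof.
case=> /card_gt0P[r _] conG S _.
have [p [rank parent]] := distance_parent (conG r).
have [|H [treeH VH _]] := @parent_tree G setT r p rank (in_setT r).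
  by move=> x _ /parent[]; rewrite inE.
exists (fun=> H); split=> [_|i j]; first by split; rewrite // VH subsetT.
by rewrite !ord1 eqxx.
Qed.

(** * Upper bounds *)

(** If the trees were edge-disjoint, the vertices could be written as [a], [b],
[c] with [ab] an edge of the first tree and [ac] an edge of the second. The
second tree then has to reach [b] by [bc], and the first tree has to reach [c]
by the same edge. *)
Lemma trees_on_triple_meet (G : sgraph) (S : {set G}) (H1 H2 : subgraph G) :
    #|S| = 3 -> steiner_tree S H1 -> steiner_tree S H2 ->
    sub_vertices H1 = S -> sub_vertices H2 = S ->
  sub_edges H1 :&: sub_edges H2 != set0.
Proof.
move=> S3 T1 T2 V1 V2; apply/negP=> /eqP disj.
have meet x y : sub_adj H1 x y -> sub_adj H2 x y -> False.
  rewrite /sub_adj => xy1 xy2.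
  by move/setP/(_ [set x; y]): disj; rewrite !inE xy1 xy2.
have nbr (H : subgraph G) x : steiner_tree S H -> sub_vertices H = S ->
    x \in S -> exists y, [/\ y \in S, y != x & sub_adj H x y].
  move=> TH VH xS.
  have [z /setD1P[zx zS]] : exists z, z \in S :\ x.
    by apply/card_gt0P; move: S3; rewrite (cardsD1 x) xS add1n => -[->].
  have [y xy] := steiner_tree_neighbour TH xS zS zx.
  exists y; split=> //; first by rewrite -VH (sub_adj_vertex xy).
  by rewrite eq_sym (sub_adj_neq xy).
have [a aS] : exists a, a \in S by apply/card_gt0P; rewrite S3.
have [b [bS ba ab1]] := nbr H1 a T1 V1 aS.
have [c [cS ca ac2]] := nbr H2 a T2 V2 aS.
have bc : b != c by apply/eqP=> E; apply: (meet a b) => //; rewrite E.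
have ES : S = [set a; b; c].
  apply/esym/eqP; rewrite eqEcard S3 -setUA cardsU1 cards2 !inE !(eq_sym a).
  by rewrite negb_or ba ca bc !subUset !sub1set aS bS cS.
have [x [xS xb bx2]] := nbr H2 b T2 V2 bS.
have [y [yS yc cy1]] := nbr H1 c T1 V1 cS.
have Ex : x = c.
  move: xS xb bx2; rewrite ES !inE -orbA => /or3P[]/eqP-> //; last by rewrite eqxx.
  by rewrite sub_adj_sym => _ /(meet a b ab1).
have Ey : y = b.
  move: yS yc cy1; rewrite ES !inE -orbA => /or3P[]/eqP-> //; last by rewrite eqxx.
  by rewrite sub_adj_sym => _ /(meet a c)/(_ ac2).
by apply: (meet c b); rewrite -?Ey // sub_adj_sym Ey -Ex.
Qed.

Lemma ex_set_card (T : finType) (k : nat) (A : {set T}) :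
  #|A| <= k <= #|T| -> exists2 S : {set T}, A \subset S & #|S| = k.
Proof.
case/andP=> Ak kT; elim: k Ak kT => [|k IHk].
  by rewrite leqn0 => /eqP A0; exists A.
rewrite leq_eqVlt => /orP[/eqP <-|/ltnSE Ak] kT; first by exists A.
have [S AS Sk] := IHk Ak (ltnW kT).
have /card_gt0P[x] : 0 < #|~: S| by rewrite cardsCs setCK Sk subn_gt0.
rewrite inE => xS; exists (x |: S); last by rewrite cardsU1 xS Sk.
exact: subset_trans AS (subsetUr _ _).
Qed.

(** Label each tree by one of its vertices outside [S], or by a fixed [b] in [S]
if it has none. Distinct trees get distinct labels, and the labels lie in [b]
together with the complement of [S]. *)
Lemma disjoint_trees_bound (G : sgraph) (r : nat) :
  3 <= #|G| -> has_disjoint_trees G 3 r -> r <= #|G| - 2.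
Proof.
move=> G3 hasr.
have [|S _ S3] := @ex_set_card G 3 set0; first by rewrite cards0.
have [t [treet disj]] := hasr S S3.
have [b bS] : exists b, b \in S by apply/card_gt0P; rewrite S3.
have /fin_all_exists[f fP] i : exists x,
    if x \in S then x = b /\ sub_vertices (t i) = S
    else x \in sub_vertices (t i).
  have [_ sSV] := treet i.
  have [Vi|] := eqVneq (sub_vertices (t i)) S; first by exists b; rewrite bS.
  rewrite eqEsubset sSV andbT => /subsetPn[x xV xS].
  by exists x; rewrite (negPf xS).
have f_inj : injective f.
  move=> i j fij; apply/eqP/negPn/negP=> /disj[Eij Vij].
  move: (fP i) (fP j); rewrite fij; case: ifP => [_ [_ Vi] [_ Vj]|fS fi fj].
    have := trees_on_triple_meet S3 (treet i) (treet j) Vi Vj.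
    by rewrite Eij eqxx.
  by move: fS; rewrite -Vij inE fi fj.
rewrite -[r]card_ord -(card_codom f_inj).
have -> : #|G| - 2 = #|b |: ~: S|.
  by rewrite cardsU1 inE bS cardsCs setCK S3 add1n -subSn.
apply/subset_leq_card/subsetP=> _ /codomP[i ->].
by rewrite !inE; move: (fP i); case: ifP => [_ [-> _]|_ _]; rewrite ?eqxx ?orbT.
Qed.

Lemma pendant_bound (G : sgraph) (k r : nat) (u v : G) :
    (forall x, adj u x -> x = v) -> 1 < k <= #|G| ->
  has_disjoint_trees G k r -> r <= 1.
Proof.
move=> pend /andP[k1 kG] hasr; rewrite leqNgt; apply/negP=> r1.
have [|S] := @ex_set_card G k [set u]; first by rewrite cards1 kG ltnW.
rewrite sub1set => uS Sk; have [t [treet disj]] := hasr S Sk.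
have [z /setD1P[zu zS]] : exists z, z \in S :\ u.
  by apply/card_gt0P; move: k1; rewrite -Sk (cardsD1 u) uS.
have uv i : [set u; v] \in sub_edges (t i).
  have [y uy] := steiner_tree_neighbour (treet i) uS zS zu.
  by rewrite -(pend y (sub_adj_adj uy)).
have [] := disj (Ordinal (ltnW r1)) (Ordinal r1) isT.
by move/setP/(_ [set u; v]); rewrite !inE !uv.
Qed.

(** * Existence of the maximum *)

(** A bounded nonempty set of naturals has a maximum, which is unique; so the
chosen value satisfies every lower and upper bound that the set provides. *)
Lemma gen_connectivity_bounds (G : sgraph) (k r m : nat) :
    0 < r -> has_disjoint_trees G k r ->
    (forall r', has_disjoint_trees G k r' -> r' <= m) ->
  r <= gen_connectivity k G <= m.
Proof.
move=> r_gt0 hasr bound.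
pose P n := boolp.asbool (has_disjoint_trees G k n).
have exP : exists n, P n by exists r; apply/boolp.asboolP.
have boundP n : P n -> n <= m by move/boolp.asboolP/bound.
case: (ex_maxnP exP boundP) => n /boolp.asboolP hasn maxn.
have genn : is_gen_connectivity G k n.
  split=> // [|r' hasr']; last by apply/maxn/boolp.asboolP.
  by apply: leq_trans r_gt0 _; apply/maxn/boolp.asboolP.
have [_ hasg maxg] := classical_sets.xgetPex 0 (ex_intro _ n genn).
by rewrite /gen_connectivity (bound _ hasg) (maxg _ hasr).
Qed.

(** * Extremal graphs *)

Section CompleteGraph.

Variable T : finType.

Definition complete_adj : rel T := fun x y => x != y.

Lemma complete_adj_sym : symmetric complete_adj.
Proof. by move=> x y; rewrite /complete_adj eq_sym. Qed.

Lemma complete_adj_irrefl : irreflexive complete_adj.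
Proof. by move=> x; rewrite /complete_adj eqxx. Qed.

Definition complete := SGraph complete_adj_sym complete_adj_irrefl.

Lemma complete_connected : 0 < #|T| -> connected_graph complete.
Proof.
split=> // x y; have [->|xy] := eqVneq x y; first exact: connect0.
exact: connect1.
Qed.

(** The centres of the stars are [b] and the vertices outside [S]. Two distinct
centres cannot both lie in [S], and an edge common to both stars would join the
two centres and put both of them in [S]. *)
Lemma complete_has_trees (k : nat) :
  0 < k -> has_disjoint_trees complete k (#|T| - k).+1.
Proof.
move=> k_gt0 S Sk; have /card_gt0P[b bS] : 0 < #|S| by rewrite Sk.
pose C := b |: ~: S.
have cardC : #|C| = (#|T| - k).+1 by rewrite cardsU1 inE bS cardsCs setCK Sk.
have /fin_all_exists[star starP] (v : complete) : exists H : subgraph complete,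
    [/\ is_tree H, sub_vertices H = v |: S &
        sub_edges H = [set [set x; v] | x in (v |: S) :\ v]].
  apply: (@parent_tree _ (v |: S) v (fun=> v) (fun x => x != v)).
    exact: setU11.
  by move=> x _ xv; rewrite setU11 eqxx xv.
pose c (i : 'I_(#|T| - k).+1) : T := enum_val (cast_ord (esym cardC) i).
have cC i : c i \in C by apply: enum_valP.
exists (star \o c); split=> [i|i j ij] /=.
  have [treei Vi _] := starP (c i).
  by rewrite /steiner_tree Vi subsetUr.
have cij : c i != c j.
  by apply: contra ij => /eqP/enum_val_inj/cast_ord_inj->.
have centreS v : v \in C -> v \in S -> v = b.
  by rewrite !inE => /orP[/eqP->|/negPf->].
have [_ -> ->] := starP (c i); have [_ -> ->] := starP (c j).
split; apply/setP=> f; rewrite !inE.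
  apply/negP=> /andP[/imsetP[x xi ->] /imsetP[y yj E]].
  have /set2P[ciy|cij'] : c i \in [set y; c j] by rewrite -E set22.
    have /set2P[cjx|cji] : c j \in [set x; c i] by rewrite E set22.
      have cjS : c j \in S by move: xi; rewrite -cjx !inE; case: eqP.
      have ciS : c i \in S by move: yj; rewrite -ciy !inE; case: eqP.
      by rewrite (centreS _ (cC i) ciS) (centreS _ (cC j) cjS) eqxx in cij.
    by rewrite cji eqxx in cij.
  by rewrite cij' eqxx in cij.
case: (f \in S); rewrite ?orbT ?orbF //.
by apply: contraNF cij => /andP[/eqP <-].
Qed.

End CompleteGraph.

Section StarGraph.

Variables (T : finType) (v : T).

Definition star_adj : rel T := fun x y => (x == v) != (y == v).

Lemma star_adj_sym : symmetric star_adj.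
Proof. by move=> x y; rewrite /star_adj eq_sym. Qed.

Lemma star_adj_irrefl : irreflexive star_adj.
Proof. by move=> x; rewrite /star_adj eqxx. Qed.

Definition star_graph := SGraph star_adj_sym star_adj_irrefl.

Lemma star_connected : connected_graph star_graph.
Proof.
split; first by apply/card_gt0P; exists v.
have to_centre (x : star_graph) : connect (@adj star_graph) x v.
  have [->|xv] := eqVneq x v; first exact: connect0.
  by apply: connect1; rewrite /= /star_adj (negPf xv) eqxx.
move=> x y; apply: connect_trans (to_centre x) _.
by rewrite (sym_connect_sym (@adj_sym star_graph)).
Qed.

Lemma star_leaf (u x : T) : u != v -> star_adj u x -> x = v.
Proof. by rewrite /star_adj => /negPf->; case: (x =P v). Qed.

End StarGraph.

Theorem proposition1 :
  (forall (G : sgraph) (n : nat),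
      connected_graph G -> #|G| = n -> 3 <= n ->
      1 <= gen_connectivity 3 G <= n - 2) /\
  (forall n : nat, 3 <= n ->
      (exists G : sgraph,
          [/\ connected_graph G, #|G| = n & gen_connectivity 3 G = n - 2]) /\
      (exists G : sgraph,
          [/\ connected_graph G, #|G| = n & gen_connectivity 3 G = 1])).
Proof.
split=> [G n conG <- G3|n n3].
  apply: gen_connectivity_bounds => //; first exact: connected_has_tree.
  by move=> r'; apply: disjoint_trees_bound.
split.
  have conK : connected_graph (complete 'I_n).
    by apply: complete_connected; rewrite card_ord (ltn_trans _ n3).
  exists (complete 'I_n); split; rewrite ?card_ord //.
  apply/eqP; rewrite eqn_leq andbC; apply: gen_connectivity_bounds.
  - by rewrite subn_gt0.
  - have := @complete_has_trees 'I_n 3 isT.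
    by rewrite card_ord -subSn.
  - move=> r' /disjoint_trees_bound; rewrite card_ord; exact.
case: n n3 => // n n3; pose G := star_graph (ord0 : 'I_n.+1).
have conG : connected_graph G by apply: star_connected.
exists G; split; rewrite ?card_ord //.
apply/eqP; rewrite eqn_leq andbC; apply: gen_connectivity_bounds => //.
  exact: connected_has_tree.
move=> r'; apply: (@pendant_bound G 3 r' (ord_max : 'I_n.+1) ord0).
  by move=> x; apply: star_leaf; rewrite -val_eqE /= -lt0n -ltnS ltnW.
by rewrite card_ord.
Qed.
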